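(* Suppose that there exist a measurable function $V:\mathsf{X}\to[1,+\infty)$, a measurable set $\mathcal{C}\subseteq\mathsf{X}$ and a probability measure $\pi$ on $\mathsf{X}$ such that: (i) $\sup_{l\ge 0}\sup_{(x,\theta)\in\mathcal{C}\times\Theta}\mathbb{E}^{(l)}_{x,\theta}[\mathbf{r}(\tau_{\mathcal{C}})]<+\infty$ for some non-decreasing function $\mathbf{r}:\mathbb{N}\to(0,+\infty)$ such that $\sum_n 1/\mathbf{r}(n)<+\infty$; (ii) $\lim_{n\to+\infty}\sup_{x\in\mathsf{X}}V^{-1}(x)\sup_{\theta\in\Theta}\|P_\theta^n(x,\cdot)-\pi\|_{\mathrm{TV}}=0$; (iii) $\sup_{\theta\in\Theta} P_\theta V(x)\le V(x)$ for every $x\in\mathcal{C}^c$, and $\sup_{(x,\theta)\in\mathcal{C}\times\Theta}\{P_\theta V(x)+V(x)\}<+\infty$. Suppose moreover that $\xi_1,\xi_2$ are probability distributions on $\mathsf{X}$ and $\Theta$ respectively such that for any $\epsilon>0$, $\lim_{n}\mathbb{P}_{\xi_1,\xi_2}\left(D(\theta_n,\theta_{n-1})\ge\epsilon\right)=0$. Then $$\lim_{n\to+\infty}\ \sup_{\{f:\ |f|_1\le 1\}}\left|\mathbb{E}_{\xi_1,\xi_2}\left[f(X_n)-\pi(f)\right]\right|=0 ,$$ where the supremum is over measurable $f:\mathsf{X}\to\mathbb{R}$ with $|f|_1=\sup_{\mathsf{X}}|f|\le 1$.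
   Context: Setting. $(\mathsf{X},\mathcal{X})$ and $(\Theta,\mathcal{B}(\Theta))$ are measurable spaces with countably generated $\sigma$-fields. $\{P_\theta,\theta\in\Theta\}$ is a family of Markov transition kernels on $(\mathsf{X},\mathcal{X})$ such that $\theta\mapsto P_\theta(x,A)$ is measurable for all $(x,A)\in\mathsf{X}\times\mathcal{X}$; $P_\theta^n$ denotes the $n$-th iterate and $P_\theta V(x)=\int P_\theta(x,dy)V(y)$. $\{\bar P(n;\cdot,\cdot),n\ge 0\}$ is a family of transition kernels on $(\mathsf{X}\times\Theta,\mathcal{X}\otimes\mathcal{B}(\Theta))$ satisfying $\int_{A\times\Theta}\bar P(n;(x,\theta);(dx',d\theta'))=P_\theta(x,A)$ for all $n\ge0$, $(x,\theta)\in \mathsf{X}\times\Theta$, $A\in\mathcal{X}$. For an integer $l\ge 0$, $\mathbb{P}^{(l)}_{x,\theta}$ (expectation $\mathbb{E}^{(l)}_{x,\theta}$) is the law on the canonical space of the non-homogeneous Markov chain $\{(X_n,\theta_n),n\ge 0\}$ started at $(x,\theta)$ whose transition kernel from time $n$ to time $n+1$ is $\bar P(l+n;\cdot,\cdot)$. $\mathbb{P}_{x,\theta}=\mathbb{P}^{(0)}_{x,\theta}$, and $\mathbb{P}_{\xi_1,\xi_2}$ (expectation $\mathbb{E}_{\xi_1,\xi_2}$) is the law when $l=0$ and $(X_0,\theta_0)\sim\xi_1\otimes\xi_2$. Notation. $\tau_{\mathcal{C}}=\inf\{n\ge 1: X_n\in\mathcal{C}\}$. For a signed measure $\mu$, $\|\mu\|_{\mathrm{TV}}=\sup_{|f|_1\le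 1}|\mu(f)|$. $D(\theta,\theta')=\sup_{x\in\mathsf{X}}\|P_\theta(x,\cdot)-P_{\theta'}(x,\cdot)\|_{\mathrm{TV}}$. *)

(* Defs.v *)
From HB Require Import structures.
From mathcomp Require Import all_boot all_order all_algebra.
From mathcomp Require Import all_classical all_reals all_analysis.
From mathcomp Require Import measurable_realfun.

Set Implicit Arguments.
Unset Strict Implicit.
Unset Printing Implicit Defensive.

Import Order.TTheory GRing.Theory Num.Theory.
Import numFieldNormedType.Exports.

Local Open Scope classical_set_scope.
Local Open Scope ring_scope.
Local Open Scope ereal_scope.

Definition countably_generated (d : measure_display) (T : measurableType d) :=
  exists G : set (set T), countable G /\ @measurable d T = <<s G >>.

Definition unit_ball (d : measure_display) (T : measurableType d)
    (R : realType) : set (T -> R) :=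
  [set f : T -> R | measurable_fun setT f /\ forall x : T, (`|f x| <= 1)%R].

(* [tv_dist mu nu] is the norm sup_{|f|_1 <= 1} |(mu - nu)(f)| of the signed
   measure mu - nu; it is only meant for finite measures. *)
Definition tv_dist (d : measure_display) (T : measurableType d)
    (R : realType) (mu nu : {measure set T -> \bar R}) : \bar R :=
  ereal_sup [set `| \int[mu]_x (f x)%:E - \int[nu]_x (f x)%:E |
            | f in @unit_ball d T R].

Fixpoint kernel_iter (d : measure_display) (T : measurableType d)
    (R : realType) (k : R.-pker T ~> T) (n : nat) : R.-spker T ~> T :=
  match n with
  | 0 => kdirac (@measurable_id _ T setT)
  | m.+1 => mkcomp_noparam k (kernel_iter k m)
  end.

Definition kernel_dist (dX dT : measure_display) (X : measurableType dX)
    (Theta : measurableType dT) (R : realType) (P : Theta -> R.-pker X ~> X)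
    (t t' : Theta) : \bar R :=
  ereal_sup [set tv_dist (P t x) (P t' x) | x in [set: X]].

Definition coord_preimages (d : measure_display) (T : measurableType d)
    (n : nat) : set (set (nat -> T)) :=
  preimage_set_system setT (fun w : nat -> T => w n) measurable.

(* The canonical space of sequences, with the product sigma-algebra. *)
Definition trajectory (d : measure_display) (T : measurableType d) :=
  g_sigma_algebraType (\bigcup_n (@coord_preimages d T n)).

(* The sigma-algebra generated by the coordinates of index at most n. *)
Definition past (d : measure_display) (T : measurableType d) (n : nat) :
    set (set (nat -> T)) :=
  <<s \bigcup_(k in [set k | (k <= n)%N]) (@coord_preimages d T k) >>.

(* [law] is the law, on the canonical space, of the non-homogeneous Markov
   chain with initial distribution [mu] and with transition kernel [Q n] from
   time n to time n + 1: the last conjunct says that Q n (w n) A is a version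
   of the conditional probability of {w (n + 1) \in A} given [past n].  These
   conditions determine [law] uniquely; its existence is the Ionescu-Tulcea
   theorem. *)
Definition is_markov_law (d : measure_display) (T : measurableType d)
    (R : realType) (mu : {measure set T -> \bar R}) (Q : nat -> R.-pker T ~> T)
    (law : probability (@trajectory d T) R) : Prop :=
  (forall A, measurable A -> law [set w | A (w 0%N)] = mu A) /\
  (forall n F A, @past d T n F -> measurable A ->
    law (F `&` [set w | A (w n.+1)]) = \int[law]_(w in F) Q n (w n) A).

(* inf {n >= 1 | X_n \in C}, with [None] for +oo. *)
Definition return_time (dX dT : measure_display) (X : measurableType dX)
    (Theta : measurableType dT) (C : set X)
    (w : nat -> (X * Theta)%type) : option nat :=
  if pselect (exists n, (0 < n)%N && ((w n).1 \in C)) is left h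
  then Some (ex_minn h) else None.

(* Extension of r with value +oo = lim r at +oo. *)
Definition rate (R : realType) (r : nat -> R) (t : option nat) : \bar R :=
  if t is Some n then (r n)%:E else +oo.

(* Main.v *)
(* Two facts are combined.
   Tightness of V(X_n): outside C the process V(X_n) is a supermartingale, so
   on an excursion which started from C it exceeds M with probability at most
   sup_C P_theta V / M; by (i) the excursion lasts j steps with probability
   O(1 / r(j)).  Summing the minimum of both bounds over the last visit to C
   before n gives sup_n P(V(X_n) > M) -> 0.
   Coupling: E f(X_(n+N)) is compared with E [P_(theta_n)^N f (X_n)] by
   replacing the kernels P_(theta_(n+i)) with P_(theta_n) one at a time.  Each
   replacement costs at most sum_(k < i) D(theta_(n+k+1), theta_(n+k)), which
   is small with high probability, and by (ii) P_(theta_n)^N f (X_n) is close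
   to pi(f) as soon as V(X_n) <= M. *)
Require Import Defs.
From HB Require Import structures.
From mathcomp Require Import all_boot all_order all_algebra.
From mathcomp Require Import all_classical all_reals all_analysis.
From mathcomp Require Import measurable_realfun giry lra.

Set Implicit Arguments.
Unset Strict Implicit.
Unset Printing Implicit Defensive.

Import Order.TTheory GRing.Theory Num.Theory.
Import numFieldNormedType.Exports.

Local Open Scope classical_set_scope.
Local Open Scope ring_scope.
Local Open Scope ereal_scope.

(** * One-step Markov property *)

Section subprobability_of.
Context d (T : measurableType d) (R : realType) (m : {measure set T -> \bar R}).
Hypothesis m1 : m setT <= 1.

Let underlying : set T -> \bar R := m.

HB.instance Definition _ := Measure.copy underlying m.
HB.instance Definition _ := Measure_isSubProbability.Build d T R underlying m1.

Definition subprobability_of : giry T R := underlying.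

End subprobability_of.

Section kernel_bind.
Context d1 d2 (T1 : measurableType d1) (T2 : measurableType d2) (R : realType).
Variable k : R.-spker T1 ~> T2.

(** A kernel is viewed as a map into the space [giry] of subprobability measures, so that
    measurability in [x] of products and integrals comes from the operations of the Giry monad. *)
Definition kernel_giry (x : T1) : giry T2 R :=
  subprobability_of (sprob_kernel_le1 k x).

Lemma measurable_kernel_giry : measurable_fun setT kernel_giry.
Proof. by apply: measurable_giry_codensity => // B mB;
  exact: measurable_kernel. Qed.

End kernel_bind.

Section integral_bind.
Context d1 d2 (T1 : measurableType d1) (T2 : measurableType d2) (R : realType).

(* [f \_ D] is the zero measure outside of [D], which is the default element
   of [giry]. *)
Lemma integral_giry_bind_in (mu : giry T1 R) (D : set T1) (f : T1 -> giry T2 R)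
    (mD : measurable D) (mf : measurable_fun setT (f \_ D))
    (h : T2 -> \bar R) :
  measurable_fun setT h -> (forall z, 0 <= h z) ->
  \int[giry_bind mu mf]_z h z = \int[mu]_(x in D) \int[f x]_z h z.
Proof.
move=> mh h0; have /= := giry_int_bind mu mf mh h0; rewrite /giry_int => ->.
rewrite [RHS]integral_mkcond; apply: eq_integral => x _.
rewrite /patch; case: ifP => // _.
by rewrite integral_measure_zero.
Qed.

End integral_bind.

Lemma measurable_coordinate d (T : measurableType d) n :
  measurable_fun setT (fun w : trajectory T => w n).
Proof.
move=> _ B mB; apply: sub_sigma_algebra; exists n => //.
by exists B.
Qed.

Lemma past_measurable d (T : measurableType d) n (F : set (trajectory T)) :
  past n F -> measurable F.
Proof. by apply: sub_sigma_algebra2 => A [k _ kA]; exists k. Qed.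

Lemma past_coordinate d (T : measurableType d) n k (A : set T) :
  (k <= n)%N -> measurable A -> past n [set w : trajectory T | A (w k)].
Proof.
move=> kn mA; apply: sub_sigma_algebra; exists k => //.
by exists A => //; rewrite setTI.
Qed.

Lemma past_le d (T : measurableType d) m n (F : set (trajectory T)) :
  (m <= n)%N -> past m F -> past n F.
Proof.
move=> mn; apply: sub_sigma_algebra2 => A [k /= km kA].
by exists k => //=; exact: leq_trans mn.
Qed.

Lemma pastT d (T : measurableType d) n : @past d T n setT.
Proof. by rewrite -setC0; apply: sigma_algebraC; exact: sigma_algebra0. Qed.

Lemma pastI d (T : measurableType d) n (F G : set (trajectory T)) :
  past n F -> past n G -> past n (F `&` G).
Proof.
exact: (@measurableI _ (g_sigma_algebraType
  (\bigcup_(k in [set k | (k <= n)%N]) @coord_preimages d T k))).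
Qed.

(** The inner integral is that of [h] against the product of the Dirac mass at [w j] with [k (w n)],
    hence a composition of measurable maps through [giry]. *)
Lemma measurable_integral_coordinates d (T : measurableType d) (R : realType)
    (k : R.-pker T ~> T) n j (h : T * T -> \bar R) :
  measurable_fun setT h -> (forall z, 0 <= h z) ->
  measurable_fun setT
    (fun w : trajectory T => \int[k (w n)]_z h (w j, z)).
Proof.
move=> mh h0.
have -> : (fun w : trajectory T => \int[k (w n)]_z h (w j, z)) =
    giry_int^~ h \o (fun w => giry_prod (giry_ret (w j), kernel_giry k (w n))).
  apply/funext => w /=; rewrite giry_int_prod1// giry_int_ret//.
  exact: measurable_fun_fubini_tonelli_F.
apply: measurableT_comp; first exact: measurable_giry_int.
apply: measurableT_comp; first exact: measurable_giry_prod.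
apply: measurable_fun_pair.
  apply: measurableT_comp; first exact: measurable_giry_ret.
  exact: measurable_coordinate.
apply: measurableT_comp; first exact: measurable_kernel_giry.
exact: measurable_coordinate.
Qed.

Section markov_step.
Context d (T : measurableType d) (R : realType).
Variables (mu : {measure set T -> \bar R}) (Q : nat -> R.-pker T ~> T).
Variable law : probability (trajectory T) R.
Hypothesis law_markov : is_markov_law mu Q law.

Lemma markov_initial (h : T -> \bar R) :
  measurable_fun setT h -> (forall z, 0 <= h z) ->
  \int[law]_w h (w 0%N) = \int[mu]_z h z.
Proof.
move=> mh h0.
have := @ge0_integral_pushforward _ _ _ _ R (fun w : trajectory T => w 0%N)
  (measurable_coordinate 0) law setT h measurableT mh.
rewrite preimage_setT => <-; last by move=> x _.
have [law0 _] := law_markov.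
apply: eq_measure_integral; first exact: measurable_coordinate.
by move=> ? A mA _; exact: law0.
Qed.

(* Both sides are integrals of [h] against measures on T * T, which agree on
   rectangles. *)
Lemma markov_step n j (F : set (trajectory T)) (h : T * T -> \bar R) :
  (j <= n)%N -> past n F -> measurable_fun setT h -> (forall z, 0 <= h z) ->
  \int[law]_(w in F) h (w j, w n.+1) =
  \int[law]_(w in F) \int[Q n (w n)]_z h (w j, z).
Proof.
move=> jn Fn mh h0; have mF := past_measurable Fn.
(* [f1] is the Dirac mass at the observed pair, [f2] the conditional law of that pair given the past
   of time [n]. *)
pose f1 (w : trajectory T) : giry (T * T)%type R := giry_ret (w j, w n.+1).
pose f2 (w : trajectory T) : giry (T * T)%type R :=
  giry_prod (giry_ret (w j), kernel_giry (Q n) (w n)).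
have mf1 : measurable_fun setT (f1 \_ F).
  apply/(measurable_restrictT _ mF)/measurable_funTS.
  apply: measurableT_comp; first exact: measurable_giry_ret.
  by apply: measurable_fun_pair; exact: measurable_coordinate.
have mf2 : measurable_fun setT (f2 \_ F).
  apply/(measurable_restrictT _ mF)/measurable_funTS.
  apply: measurableT_comp; first exact: measurable_giry_prod.
  apply: measurable_fun_pair.
    apply: measurableT_comp; first exact: measurable_giry_ret.
    exact: measurable_coordinate.
  apply: measurableT_comp; first exact: measurable_kernel_giry.
  exact: measurable_coordinate.
pose L : giry (trajectory T) R := law.
have <- : \int[giry_bind L mf1]_z h z = \int[law]_(w in F) h (w j, w n.+1).
  rewrite integral_giry_bind_in//; apply: eq_integral => w _.
  by rewrite integral_dirac// diracT mul1e.
have <- : \int[giry_bind L mf2]_z h z =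
    \int[law]_(w in F) \int[Q n (w n)]_z h (w j, z).
  rewrite integral_giry_bind_in//; apply: eq_integral => w _.
  rewrite fubini_tonelli1// integral_dirac ?diracT ?mul1e//.
  exact: measurable_fun_fubini_tonelli_F.
apply: eq_measure_integral => A0 mA0 _.
pose G : set (set (T * T)) :=
  [set A `*` B | A in measurable & B in measurable].
apply: (measure_unique G (fun=> setT)) => //.
- exact: measurable_prod_measurableType.
- move=> _ _ [A1 mA1 [A2 mA2 <-]] [B1 mB1 [B2 mB2 <-]].
  exists (A1 `&` B1); first exact: measurableI.
  by exists (A2 `&` B2); [exact: measurableI|rewrite setXI].
- by move=> _; exists setT => //; exists setT => //; rewrite setXTT.
- by rewrite bigcup_const.
- move=> _ [A1 mA1 [A2 mA2 <-]].
  have mA : measurable (A1 `*` A2) by exact: measurableX.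
  have mI : measurable_fun setT (EFin \o \1_(A1 `*` A2) : T * T -> \bar R).
    by apply/measurable_EFinP; exact: measurable_indic.
  have E (m : {measure set (T * T)%type -> \bar R}) :
      m (A1 `*` A2) = \int[m]_z (\1_(A1 `*` A2) z)%:E.
    by rewrite integral_indic// setIT.
  rewrite !E.
  have I0 z : 0 <= (\1_(A1 `*` A2) z)%:E :> \bar R by rewrite lee_fin.
  rewrite !integral_giry_bind_in//.
  (* On a rectangle the condition on [w j] belongs to the past, since [j <= n]; the identity is then
     the defining property of [is_markov_law]. *)
  transitivity (law ((F `&` [set w | A1 (w j)]) `&` [set w | A2 (w n.+1)])).
    rewrite -setIA [in RHS]setIC.
    rewrite -(integral_indic _ mF); last first.
      apply: measurableI.
        by rewrite -[X in measurable X]setTI; exact: measurable_coordinate.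
      by rewrite -[X in measurable X]setTI; exact: measurable_coordinate.
    apply: eq_integral => w _.
    by rewrite integral_dirac// diracT mul1e.
  have [_ ->//] := law_markov; last exact: pastI Fn (past_coordinate jn mA1).
  rewrite integral_mkcondr; apply: eq_integral => w _.
  rewrite integral_indic// setIT//.
  transitivity (giry_ret (R := R) (w j) A1 * Q n (w n) A2); last first.
    exact/esym/product_measure1E.
  rewrite /giry_ret/= diracE /patch.
  have -> : (w \in [set w : trajectory T | A1 (w j)]) = (w j \in A1).
    by apply/idP/idP; rewrite !inE.
  by case: (w j \in A1); rewrite ?mul1e ?mul0e.
- move=> _; apply: (@le_lt_trans _ _ 1); last exact: ltry.
  exact: (@sprobability_setT _ _ _ (giry_bind L mf1)).
Qed.
End markov_step.

(** * Visits to a set *)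

Section avoidance.
Context d (T : measurableType d) (R : realType).
Variables (Q : nat -> R.-pker T ~> T) (C : set T).
Hypothesis mC : measurable C.
Let mC' : measurable (~` C). Proof. exact: measurableC. Qed.

(** Time [k] itself is left free: for [k = 0] this is the event that the return time to [C], counted
    from time 1, exceeds [m]. *)
Definition avoid (k m : nat) : set (trajectory T) :=
  [set w | forall i, (k < i <= k + m)%N -> ~ C (w i)].

Lemma avoid0 k : avoid k 0 = setT.
Proof.
by apply/seteqP; split => // w _ i; rewrite addn0 ltnNge andNb.
Qed.

Lemma avoidSr k m : avoid k m.+1 = avoid k m `&` [set w | (~` C) (w (k + m).+1%N)].
Proof.
apply/seteqP; split => [w wA|w [wA wC] i].
  split => [i /andP[ki im]|]; apply: wA; rewrite ?ki ?addnS//=.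
    exact: leqW.
  by rewrite ltnS leq_addr leqnn.
rewrite addnS => /andP[ki]; rewrite leq_eqVlt => /predU1P[->//|];
  rewrite ltnS => im.
by apply: wA; rewrite ki.
Qed.

Lemma avoidSl k m : avoid k m.+1 = [set w | (~` C) (w k.+1)] `&` avoid k.+1 m.
Proof.
apply/seteqP; split => [w wA|w [wC wA] i].
  split => [|i /andP[ki im]]; apply: wA.
    by rewrite leqnn addnS ltnS leq_addr.
  by rewrite (ltnW ki) addnS -addSn.
rewrite leq_eqVlt => /andP[/predU1P[<-//|ki]].
by rewrite addnS -addSn => im; apply: wA; rewrite ki.
Qed.

Lemma past_avoid k m : past (k + m)%N (avoid k m).
Proof.
elim: m => [|m ih]; first by rewrite avoid0; exact: pastT.
rewrite avoidSr addnS; apply: pastI; first exact: past_le ih.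
exact: past_coordinate (leqnn _) mC'.
Qed.

(** The probability, from [z] at time [l], of staying outside [C] for the next [m] steps. Built from
    the kernels alone, it links the laws started at a point to the chain with an arbitrary initial
    law. *)
Fixpoint avoid_prob (m l : nat) (z : T) : \bar R :=
  if m is m'.+1 then \int[Q l z]_(y in ~` C) avoid_prob m' l.+1 y else 1.

Lemma avoid_prob_ge0 m l z : 0 <= avoid_prob m l z.
Proof. by elim: m l z => //= m ih l z; apply: integral_ge0. Qed.

Lemma measurable_avoid_prob m l : measurable_fun setT (avoid_prob m l).
Proof.
elim: m l => //= m ih l.
under eq_fun do rewrite integral_mkcond.
apply: measurable_fun_integral_kernel.
- by move=> U mU; exact: measurable_kernel.
- by move=> z; apply: erestrict_ge0 => y _; exact: avoid_prob_ge0.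
- apply/(measurable_restrictT _ mC').
  exact: measurable_funTS.
Qed.

(** Induction on [m] for all [k] and [F]: the first avoided step is moved into the past event, then
    [markov_step] integrates it out. *)
Lemma avoid_probE (mu : {measure set T -> \bar R})
  (law : probability (trajectory T) R)
    l k m (F : set (trajectory T)) :
  is_markov_law mu (fun n => Q (l + n)%N) law -> past k F ->
  law (F `&` avoid k m) = \int[law]_(w in F) avoid_prob m (l + k)%N (w k).
Proof.
move=> law_markov; elim: m k F => [|m ih] k F kF.
  by rewrite avoid0 setIT/= integral_cst ?mul1e//; exact: past_measurable kF.
rewrite avoidSl setIA ih; last first.
  by apply: pastI; [exact: past_le kF|exact: past_coordinate (leqnn _) mC'].
pose h (z : T * T) := (avoid_prob m (l + k.+1)%N \_ (~` C)) z.2.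
rewrite integral_mkcondr.
transitivity (\int[law]_(w in F) h (w k, w k.+1)).
  apply: eq_integral => w _; rewrite /h /patch /=.
  by congr (if _ then _ else _); apply/idP/idP; rewrite !inE.
rewrite (markov_step law_markov (leqnn k) kF).
- by apply: eq_integral => w _;
    rewrite /h addnS [RHS]/= [in RHS]integral_mkcond.
- apply: measurableT_comp => //; apply/(measurable_restrictT _ mC').
  by apply: measurable_funTS; exact: measurable_avoid_prob.
- by move=> z; apply: erestrict_ge0 => y _; exact: avoid_prob_ge0.
Qed.

(** Lets bounds on return times, known for chains started at a point, act under every law with the
    same kernels. *)
Lemma avoid_prob_dirac (law : probability (trajectory T) R) l m z :
  is_markov_law \d_z (fun n => Q (l + n)%N) law ->
  avoid_prob m l z = law (avoid 0 m).
Proof.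
move=> law_markov; rewrite -[avoid 0 m]setTI (avoid_probE _ law_markov (@pastT _ T 0)).
rewrite (markov_initial law_markov).
- by rewrite integral_dirac ?diracT ?mul1e ?addn0//;
    exact: measurable_avoid_prob.
- exact: measurable_avoid_prob.
- by move=> y; exact: avoid_prob_ge0.
Qed.

End avoidance.

(* Unlike [ge0_le_integral], this does not ask for the measurability of [f]. *)
Lemma le_integral_lower d (T : measurableType d) (R : realType)
    (mu : {measure set T -> \bar R}) (E : set T) (c : R) (f : T -> \bar R) :
  measurable E -> (0 <= c)%R -> (forall x, 0 <= f x) ->
  (forall x, E x -> c%:E <= f x) -> c%:E * mu E <= \int[mu]_x f x.
Proof.
move=> mE c0 f0 cf.
rewrite ge0_integralTE//; apply: ereal_sup_ubound => /=.
exists (scale_nnsfun (indic_nnsfun R mE) c0).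
  move=> x /=; rewrite mindicE; case: (boolP (x \in E)) => [/set_mem/cf|_] /=.
    by rewrite mulr1.
  by rewrite mulr0.
by rewrite sintegralrM/= sintegral_indic.
Qed.

(** * Limits equal to zero, tails and last visits *)

Lemma cvge0_near_lt (R : realType) (u : nat -> \bar R) (e : R) :
  u n @[n --> \oo] --> 0 -> (0 < e)%R -> exists N, forall n, (N <= n)%N ->
    u n < e%:E.
Proof.
move=> u0 e0.
have [N _ uN] : \forall n \near \oo, u n < e%:E.
  exact: (u0 [set y | y < e%:E] (@nbhs_open_ereal_lt _ 0%R (fun=> e) e0)).
by exists N.
Qed.

Lemma cvge0_near_le (R : realType) (u : nat -> \bar R) :
  (forall n, 0 <= u n) ->
  (forall e : R, (0 < e)%R -> exists N, forall n, (N <= n)%N -> u n <= e%:E) ->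
  u n @[n --> \oo] --> 0.
Proof.
move=> u0 ue; apply/fine_cvgP; split.
  have [N uN] := ue 1%R ltr01; exists N => // n /= /uN un.
  by rewrite ge0_fin_numE// (le_lt_trans un)// ltry.
apply/cvgr0Pnorm_le => e e0; have [N uN] := ue _ e0; exists N => // n /= /uN.
rewrite ger0_norm ?fine_ge0//.
by case: (u n) (u0 n) => [x|//|//] /=; rewrite ?lee_fin.
Qed.

(** Continuity from above along the events [n.+1 < V], whose intersection is empty; the shift by one
    keeps the level positive. *)
Lemma probability_tail d (T : measurableType d) (R : realType)
    (law : probability T R) (V : T -> R) (e : R) :
  measurable_fun setT V -> (0 < e)%R ->
  exists2 K : R, (0 < K)%R & law [set w | (K < V w)%R] < e%:E.
Proof.
move=> mV e0.
pose F (n : nat) := [set w | (n.+1%:R < V w)%R].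
have mF n : measurable (F n).
  have -> : F n = V @^-1` `]n.+1%:R, +oo[.
    by apply/seteqP; split => w /=; rewrite in_itv/= andbT.
  by rewrite -[X in measurable X]setTI; exact: mV.
have F0 : \bigcap_n F n = set0.
  apply/seteqP; split => // w wF; have := wF (Num.truncn `|V w|)%R I.
  rewrite /F/= ltNge => /negP; apply.
  by rewrite (le_trans (ler_norm _))// ltW// truncnS_gt.
have : (law \o F) n @[n --> \oo] --> law (\bigcap_n F n).
  apply: nonincreasing_cvg_mu => //.
  - by rewrite (le_lt_trans (probability_le1 _ _)) ?ltry.
  - exact: bigcap_measurable.
  - move=> m n mn; apply/subsetPset => w; rewrite /F/=.
    by apply: le_lt_trans; rewrite ler_nat.
rewrite F0 measure0 => /cvge0_near_lt/(_ e0)[N /(_ N (leqnn N)) lawN].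
by exists N.+1%:R.
Qed.

(** When the last visit is at time [n - j.+1], the path has made [j.+1] steps outside [C] since. In
    the induction on [n], one more step outside [C] raises [j] by one, or starts an excursion with
    [j = 0]. *)
Lemma last_visit (T : Type) (C : set T) (w : nat -> T) n :
  [\/ forall i, (i <= n)%N -> ~ C (w i), C (w n) |
    exists2 j, (j < n)%N & C (w (n - j.+1)%N) /\
      forall i, (n - j.+1 < i <= n)%N -> ~ C (w i)].
Proof.
elim: n => [|n ih].
  have [C0|nC0] := pselect (C (w 0%N)); first by constructor 2.
  by constructor 1 => i; rewrite leqn0 => /eqP ->.
have [Cn|nCn] := pselect (C (w n.+1)); first by constructor 2.
case: ih => [ih|Cn|[j jn [Cj ih]]].
- by constructor 1 => i; rewrite leq_eqVlt => /predU1P[->//|]; exact: ih.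
- constructor 3; exists 0%N => //; rewrite subn1/=; split => // i.
  by rewrite -eqn_leq => /eqP <-.
- constructor 3; exists j.+1 => //; rewrite subSS; split => // i /andP[ji].
  by rewrite leq_eqVlt => /predU1P[->//|]; rewrite ltnS => ni; apply: ih;
    rewrite ji.
Qed.

(** * Tightness along excursions *)

(** The return time then exceeds [m] or is infinite, and [rate] is [+oo] in the latter case. *)
Lemma rate_return_time_ge (dX dT : measure_display) (X : measurableType dX)
    (Theta : measurableType dT) (R : realType) (r : nat -> R) (C : set X)
    (m : nat) (w : trajectory (X * Theta)%type) :
  {homo r : m n / (m <= n)%N >-> (m <= n)%R} ->
  avoid (fst @^-1` C) 0 m w -> (r m)%:E <= rate r (return_time C w).
Proof.
move=> r_nd wm; rewrite /return_time; case: pselect => [h|_] /=;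
  last exact: leey.
case: ex_minnP => n /andP[n0 /set_mem nC] _; rewrite lee_fin; apply: r_nd.
by rewrite leqNgt; apply/negP => nm; apply: (wm n) => //; rewrite n0 ltnW.
Qed.

Lemma ereal_sup_bounded (R : realType) (S : set (\bar R)) :
  ereal_sup S < +oo -> exists2 A : R, (0 <= A)%R & forall x, S x -> x <= A%:E.
Proof.
(* The maximum with [0] also covers a supremum equal to [-oo], which occurs when [C] is empty. *)
move=> Soo; exists (Num.max 0 (fine (ereal_sup S)))%R.
  by rewrite le_max lexx.
move=> x /ereal_sup_ubound xS; apply: (le_trans xS).
case: (ereal_sup S) Soo => [s _|//|_] /=; last exact: leNye.
by rewrite lee_fin le_max lexx orbT.
Qed.

Section tightness.
Context d (T : measurableType d) (R : realType).
Variables (mu : {measure set T -> \bar R}) (Q : nat -> R.-pker T ~> T).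
Variable law : probability (trajectory T) R.
Hypothesis law_markov : is_markov_law mu Q law.
Variables (C : set T) (V : T -> R) (a : nat -> R) (B : R).
Hypothesis mC : measurable C.
Hypothesis mV : measurable_fun setT V.
Hypothesis V0 : forall z, (0 <= V z)%R.
Hypothesis a_sum : \sum_(0 <= n <oo) (a n)%:E < +oo.
Hypothesis a0 : forall n, (0 <= a n)%R.
Hypothesis C_avoid : forall m l z, C z -> avoid_prob Q C m l z <= (a m)%:E.
Hypothesis B0 : (0 <= B)%R.
Hypothesis C_drift : forall l z, C z -> \int[Q l z]_y (V y)%:E <= B%:E.
Hypothesis C_bounded : forall z, C z -> (V z <= B)%R.
Hypothesis drift : forall l z, ~ C z -> \int[Q l z]_y (V y)%:E <= (V z)%:E.

Let mC' : measurable (~` C). Proof. exact: measurableC. Qed.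

Let mVn n (F : set (trajectory T)) : measurable_fun F (fun w : trajectory T => (V (w n))%:E).
Proof.
apply: measurable_funTS; apply/measurable_EFinP.
by apply: measurableT_comp => //; exact: measurable_coordinate.
Qed.

Let mQV n (F : set (trajectory T)) :
  measurable_fun F (fun w : trajectory T => \int[Q n (w n)]_z (V z)%:E).
Proof.
apply: measurable_funTS.
apply: (@measurableT_comp _ _ _ _ _ _ (fun z => \int[Q n z]_y (V y)%:E)).
  apply: measurable_fun_integral_kernel => //.
  - by move=> U mU; exact: measurable_kernel.
  - exact/measurable_EFinP.
exact: measurable_coordinate.
Qed.

Let step n (F : set (trajectory T)) : past n F ->
  \int[law]_(w in F) (V (w n.+1))%:E = \int[law]_(w in F) \int[Q n (w n)]_z (V z)%:E.
Proof.
move=> Fn;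
apply: (markov_step (h := fun z => (V z.2)%:E) law_markov (leqnn n) Fn).
- by apply/measurable_EFinP; exact: measurableT_comp.
- by move=> z; rewrite lee_fin.
Qed.

(** The supermartingale property outside [C]: by [drift], the integral of [V] over the paths still
    on their excursion does not increase with [m]. *)
Let excursion k m (F : set (trajectory T)) :
  past k F -> F `<=` [set w | ~ C (w k)] ->
  \int[law]_(w in F `&` avoid C k m) (V (w (k + m)%N))%:E <=
  \int[law]_(w in F) (V (w k))%:E.
Proof.
move=> Fk FC; elim: m => [|m ih]; first by rewrite avoid0 setIT addn0.
apply: le_trans ih; rewrite addnS.
have pG : past (k + m)%N (F `&` avoid C k m).
  by apply: pastI; [exact: past_le (leq_addr _ _) Fk|exact: past_avoid].
have mG := past_measurable pG.
(* The last avoidance condition is dropped, so that the event belongs to the past of time [k + m]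
   and the Markov property applies. *)
apply: (@le_trans _ _
  (\int[law]_(w in F `&` avoid C k m) (V (w (k + m).+1%N))%:E)).
  apply: ge0_subset_integral => //.
  - apply: past_measurable (k + m).+1%N _ _.
    by apply: pastI; [apply: past_le Fk; rewrite -addnS leq_addr|rewrite -addnS; exact: past_avoid].
  - by move=> w _; rewrite lee_fin.
  - by rewrite avoidSr setIA; exact: subIsetl.
rewrite step//; apply: ge0_le_integral => //.
- by move=> w _; apply: integral_ge0 => z _; rewrite lee_fin.
- move=> w [Fw Aw]; apply: drift.
  (* [avoid] says nothing about time [k], so the first step relies on [FC]. *)
  case: m Aw {pG mG} => [|m Aw]; first by rewrite addn0 => _; exact: FC.
  by apply: Aw; rewrite leqnn addnS ltnS leq_addr.
Qed.

Let mE n M : measurable [set w : trajectory T | (M < V (w n))%R].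
Proof.
have -> : [set w : trajectory T | (M < V (w n))%R] =
    (fun w => w n) @^-1` (V @^-1` `]M, +oo[).
  by apply/seteqP; split => w /=; rewrite in_itv/= andbT.
rewrite -[X in measurable X]setTI; apply: measurable_coordinate => //.
by rewrite -[X in measurable X]setTI; exact: mV.
Qed.

(** Markov's inequality for [V (w n)] restricted to [G]. *)
Let tail n M (G : set (trajectory T)) : measurable G -> (0 < M)%R ->
  law (G `&` [set w | (M < V (w n))%R]) <=
    (M^-1)%:E * \int[law]_(w in G) (V (w n))%:E.
Proof.
move=> mG M0.
have mGE : measurable (G `&` [set w : trajectory T | (M < V (w n))%R]).
  exact: measurableI.
rewrite lee_pdivlMl//.
rewrite -[law _]mul1e -integral_cst//.
rewrite -ge0_integralZl_EFin//; last exact: ltW.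
apply: (@le_trans _ _
  (\int[law]_(w in G `&` [set w | (M < V (w n))%R]) (V (w n))%:E)).
  apply: ge0_le_integral => //.
  - by move=> w _; rewrite mule1 lee_fin ltW.
  - by move=> w [_ /= /ltW]; rewrite mule1 lee_fin.
apply: ge0_subset_integral => //.
by move=> w _; rewrite lee_fin.
Qed.

(** From [C], the mean of [V] after one step is at most [B]; [excursion], started at time [k.+1],
    preserves this bound, and Markov's inequality concludes. *)
Let excursion_C k m M : (0 < M)%R ->
  law (([set w | C (w k)] `&` avoid C k m.+1) `&` [set w | (M < V (w (k + m.+1)%N))%R])
  <= (B / M)%:E.
Proof.
move=> M0.
have pF : past k.+1 ([set w | C (w k)] `&` [set w | (~` C) (w k.+1)]).
  by apply: pastI; [exact: past_coordinate mC|exact: past_coordinate mC'].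
have pk : past k [set w | C (w k)] by exact: past_coordinate mC.
apply: (le_trans (tail _ _ M0)).
  apply: past_measurable (k + m.+1)%N _ _; apply: pastI; last exact: past_avoid.
  by apply: past_coordinate => //; exact: leq_addr.
rewrite mulrC EFinM lee_pmul2l ?lte_fin ?invr_gt0//.
rewrite avoidSl setIA addnS -addSn.
apply: (le_trans (excursion _ pF _)); first by move=> w [].
apply: (@le_trans _ _ (\int[law]_(w in [set w | C (w k)]) (V (w k.+1))%:E)).
  apply: ge0_subset_integral => //.
  - exact: past_measurable pF.
  - exact: past_measurable pk.
  - by move=> w _; rewrite lee_fin.
rewrite step//.
apply: (@le_trans _ _ (\int[law]_(w in [set w : trajectory T | C (w k)]) B%:E)).
  apply: ge0_le_integral => //; first exact: past_measurable pk.
  - by move=> w _; apply: integral_ge0 => z _; rewrite lee_fin.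
  - by move=> w; exact: C_drift.
rewrite integral_cst; last exact: past_measurable pk.
rewrite -[leRHS]mule1 lee_wpmul2l ?lee_fin//; apply: probability_le1.
exact: past_measurable pk.
Qed.

(** The last of the [m.+1] avoided steps is given away, so that the bound carries the index [m] used
    in the sum over last visits. *)
Let avoid_C k m (G : set (trajectory T)) : measurable G ->
  law (([set w | C (w k)] `&` avoid C k m.+1) `&` G) <= (a m)%:E.
Proof.
move=> mG; have pk : past k [set w | C (w k)] by exact: past_coordinate mC.
have mk := past_measurable pk.
have mA m' : measurable (avoid C k m').
  by apply: past_measurable (k + m')%N _ _; exact: past_avoid.
apply: (@le_trans _ _ (law ([set w | C (w k)] `&` avoid C k m))).
  apply: le_measure; rewrite ?inE//.
  - apply: measurableI => //; apply: measurableI => //; exact: mA.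
  - by apply: measurableI => //; exact: mA.
  - by rewrite avoidSr => w [[wC []]].
rewrite (avoid_probE (l := 0) mC m law_markov pk) add0n.
apply: (@le_trans _ _
  (\int[law]_(w in [set w : trajectory T | C (w k)]) (a m)%:E)).
  apply: ge0_le_integral => //.
  - by move=> w _; exact: avoid_prob_ge0.
  - apply: measurable_funTS;
      apply: (measurableT_comp (measurable_avoid_prob _ mC m k)).
    exact: measurable_coordinate.
  - by move=> w; exact: C_avoid.
rewrite integral_cst// -[leRHS]mule1 lee_wpmul2l ?lee_fin//.
exact: probability_le1.
Qed.

(** [V] need not be integrable under the initial law, hence the truncation at [K], after which
    [excursion] and Markov's inequality apply from time 0. *)
Let excursion_0 K m M : (0 < M)%R -> (0 <= K)%R ->
  law (([set w | ~ C (w 0%N) /\ (V (w 0%N) <= K)%R] `&` avoid C 0 m) `&`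
    [set w | (M < V (w m))%R]) <= (K / M)%:E.
Proof.
move=> M0 K0; set F := [set w | _ /\ _].
have pF : past 0 F.
  have mD : measurable ((~` C) `&` (V @^-1` `]-oo, K])).
    apply: measurableI => //.
    by rewrite -[X in measurable X]setTI; exact: mV.
  rewrite (_ : F = [set w | ((~` C) `&` (V @^-1` `]-oo, K])) (w 0%N)]).
    exact: past_coordinate mD.
  by apply/seteqP; split => w /=; rewrite in_itv.
have mF := past_measurable pF.
apply: (le_trans (tail _ _ M0)).
  apply: past_measurable (0 + m)%N _ _; apply: pastI; last exact: past_avoid.
  exact: past_le pF.
rewrite mulrC EFinM lee_pmul2l ?lte_fin ?invr_gt0//.
apply: (le_trans (excursion m pF _)); first by move=> w [].
apply: (@le_trans _ _ (\int[law]_(w in F) K%:E)).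
  apply: ge0_le_integral => //.
  - by move=> w _; rewrite lee_fin.
  - by move=> w [_]; rewrite lee_fin.
rewrite integral_cst// -[leRHS]mule1 lee_wpmul2l ?lee_fin//.
exact: probability_le1.
Qed.

(* Decompose {M < V (X_n)} according to the last visit to [C]: an excursion of
   length j + 1 contributes at most min (a j) (B / M), and the contribution of
   the paths which have not visited [C] is at most K / M, up to
   P (K < V (X_0)). *)
Lemma markov_tight (e : R) : (0 < e)%R ->
  exists2 M : R, (0 < M)%R &
    forall n, law [set w | (M < V (w n))%R] <= e%:E.
Proof.
move=> e0; have e30 : (0 < e / 3)%R by rewrite divr_gt0.
have mV0 : measurable_fun setT (fun w : trajectory T => V (w 0%N)).
  by apply: measurableT_comp => //; exact: measurable_coordinate.
have [K K0 lawK] := probability_tail law mV0 e30.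
(* [J] separates the short excursions, each bounded by [B / M], from the long ones, bounded together
   by the tail of the series. *)
have [J /(_ J (leqnn J)) aJ] : exists J, forall n, (J <= n)%N ->
    \sum_(n <= j <oo) (a j)%:E < (e / 3)%:E.
  apply: cvge0_near_lt => //; apply: nneseries_tail_cvg => // n _.
  by rewrite lee_fin.
(* The second term makes [K / M] plus [J] times [B / M] at most [e / 3]; [M >= B] excludes that
   [w n] lies in [C]. *)
pose M := (Num.max B ((K + B *+ J) / (e / 3)))%R.
have KB : (0 < K + B *+ J)%R by rewrite ltr_wpDr// mulrn_wge0.
have M0 : (0 < M)%R by rewrite lt_max (divr_gt0 KB)// orbT.
exists M => // n.
pose A0 := [set w : trajectory T | (K < V (w 0%N))%R].
pose A1 : set (trajectory T) :=
  ([set w | ~ C (w 0%N) /\ (V (w 0%N) <= K)%R] `&` avoid C 0 n) `&`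
    [set w | (M < V (w n))%R].
pose A2 j : set (trajectory T) :=
  ([set w | C (w (n - j.+1)%N)] `&` avoid C (n - j.+1)%N j.+1) `&`
    [set w | (M < V (w n))%R].
have mav k m : measurable (avoid C k m).
  by apply: past_measurable (k + m)%N _ _; exact: past_avoid.
have mA0 : measurable A0 by exact: mE.
have mA1 : measurable A1.
  apply: measurableI => //; apply: measurableI => //.
  apply: measurableI; last first.
    have -> : (fun w : trajectory T => is_true (V (w 0%N) <= K)%R) = ~` A0.
      by apply/seteqP; split => w /=; rewrite leNgt => /negP.
    exact: measurableC.
  exact: past_measurable (past_coordinate (leqnn 0) mC').
have mA2 j : measurable (A2 j).
  apply: measurableI => //; apply: measurableI => //.
  exact: past_measurable (past_coordinate (leqnn _) mC).
have mA2s : measurable (\big[setU/set0]_(j < n) A2 j)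
  by exact: bigsetU_measurable.
have cover : [set w | (M < V (w n))%R] `<=` A0 `|`
  (A1 `|` \big[setU/set0]_(j < n) A2 j).
  move=> w Mw; have [wC|wC|[j jn [wC wj]]] := last_visit C w n.
  - have [VK|VK] := ltP K (V (w 0%N)); [by left|right; left].
    by split => //; split => [|i /andP[_]]; [split => //; exact: wC|exact: wC].
  - have := C_bounded wC; move: Mw;
      rewrite /= gt_max => /andP[/lt_le_trans h _] /h.
    by rewrite ltxx.
  - right; right; rewrite -bigcup_mkord; exists j => //; split => //;
      split => //.
    by move=> i; rewrite subnK//; exact: wj.
apply: (@le_trans _ _ (law A0 + (law A1 + \sum_(0 <= j < n) law (A2 j)))).
  have mA12 : measurable (A1 `|` \big[setU/set0]_(j < n) A2 j)
    by exact: measurableU.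
  apply: (@le_trans _ _ (law (A0 `|` (A1 `|` \big[setU/set0]_(j < n) A2 j)))).
    by apply: le_measure; rewrite ?inE//; exact: measurableU.
  apply: (le_trans (measureU2 _ mA0 mA12)); apply: leeD2l.
  apply: (le_trans (measureU2 _ mA1 mA2s)); apply: leeD2l.
  rewrite big_mkord; exact: Boole_inequality.
have A2C j : (j < n)%N -> law (A2 j) <= (B / M)%:E.
  by move=> jn; have := excursion_C (n - j.+1) j M0; rewrite subnK.
have A2a j : law (A2 j) <= (a j)%:E by apply: avoid_C; exact: mE.
have sumJ J' : (J' <= n)%N -> \sum_(0 <= j < J') law (A2 j) <= (B / M *+ J')%:E.
  move=> Jn; apply: (@le_trans _ _ (\sum_(0 <= j < J') (B / M)%:E)).
    rewrite big_nat [leRHS]big_nat; apply: lee_sum => j /andP[_ jJ].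
    by apply: A2C; exact: leq_trans Jn.
  by rewrite sumEFin big_const_nat subn0 iter_addr_0.
have sumA2 : \sum_(0 <= j < n) law (A2 j) <= (B / M *+ J)%:E + (e / 3)%:E.
  have BM : (0 <= B / M)%R by rewrite divr_ge0// ltW.
  have [nJ|Jn] := leqP n J.
    apply: (le_trans (sumJ _ (leqnn n))); rewrite -EFinD lee_fin.
    by rewrite -[leLHS]addr0 lerD ?(ltW e30)// ler_wpMn2l.
  rewrite (big_cat_nat (leq0n J) (ltnW Jn)) /=; apply: leeD;
    first exact: sumJ (ltnW Jn).
  apply: le_trans (ltW aJ).
  apply: (@le_trans _ _ (\sum_(J <= j < n) (a j)%:E)); first
    by apply: lee_sum => j _.
  by apply: nneseries_lim_ge => j _ _; rewrite lee_fin.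
have A1K : law A1 <= (K / M)%:E by apply: excursion_0 => //; exact: ltW.
apply: (le_trans (leeD (ltW lawK) (leeD A1K sumA2))).
rewrite -!EFinD lee_fin.
have : ((K + B *+ J) / M <= e / 3)%R.
  by rewrite ler_pdivrMr// mulrC -ler_pdivrMr// le_max lexx orbT.
rewrite -mulrnAl mulrDl; lra.
Qed.

End tightness.

(** * Freezing the kernel *)

(** Serves to rescale functions from [-1, 1] to [0, 1], and to subtract the constant [pi(f)] inside
    the expectation. *)
Lemma integral_affine d (T : measurableType d) (R : realType)
    (mu : probability T R) (u : T -> R) (p q : R) :
  measurable_fun setT u -> (forall x, `|u x| <= 1)%R ->
  \int[mu]_x (p * u x + q)%:E = (p * (\int[mu]_x u x)%R + q)%:E.
Proof.
move=> mu_ u1.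
have iu : mu.-integrable setT (EFin \o u).
  apply: measurable_bounded_integrable => //; first
    by rewrite (le_lt_trans (probability_le1 _ _)) ?ltry.
  by exists 1%R; split => // M M1 x _; exact: le_trans (u1 x) (ltW M1).
under eq_integral do rewrite EFinD EFinM.
have ipu : mu.-integrable setT (fun x => p%:E * (u x)%:E)
  by exact: integrableZl.
have iq : mu.-integrable setT (fun=> q%:E).
  exact: (finite_measure_integrable_cst mu q measurableT).
rewrite integralD//.
rewrite integralZl// integral_cst//=.
have -> : mu setT = 1 by exact: probability_setT.
by rewrite mule1 /Rintegral EFinD EFinM fineK//; exact: integrable_fin_num.
Qed.

(** A function with values in [0, 1] lies in the unit ball, and both integrals are finite because
    the masses are at most 1. The additive one-sided form avoids differences of extended reals in
    later estimates. *)
Lemma tv_dist_le_integral d (T : measurableType d) (R : realType)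
    (mu nu : {measure set T -> \bar R}) (e : R) (h : T -> \bar R) :
  mu setT <= 1 -> nu setT <= 1 -> tv_dist mu nu <= e%:E ->
  measurable_fun setT h -> (forall x, 0 <= h x <= 1) ->
  \int[mu]_x h x <= \int[nu]_x h x + e%:E.
Proof.
move=> mu1 nu1 mn mh h01.
have hE x : (fine (h x))%:E = h x.
  have /andP[h0 h1] := h01 x; rewrite fineK// ge0_fin_numE//.
  exact: le_lt_trans h1 (ltry _).
have fin (m : {measure set T -> \bar R}) : m setT <= 1 ->
  \int[m]_x h x \is a fin_num.
  move=> m1; rewrite ge0_fin_numE; last first.
    by apply: integral_ge0 => x _; case/andP: (h01 x).
  apply: (@le_lt_trans _ _ 1); last exact: ltry.
  apply: (@le_trans _ _ (\int[m]_x 1)); last by rewrite integral_cst// mul1e.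
  by apply: ge0_le_integral => // x _; case/andP: (h01 x).
have := fin _ mu1; have := fin _ nu1.
have : `| \int[mu]_x h x - \int[nu]_x h x| <= e%:E.
  apply: le_trans mn; apply: ereal_sup_ubound; exists (fine \o h).
    split => [|x]; first exact: measurableT_comp.
    have /andP[h0 h1] := h01 x.
    by rewrite ger0_norm ?fine_ge0// -lee_fin hE.
  by congr (`| _ - _|); apply: eq_integral => x _ /=; rewrite hE.
case: (\int[mu]_x h x) (\int[nu]_x h x) => [a|//|//] [b|//|//].
rewrite -EFinB abse_EFin -EFinD !lee_fin => /ler_normlP[_ ab] _ _.
by rewrite -lerBlDl.
Qed.

(** Replaces a possibly non-measurable event of small outer probability by a measurable one, the
    union of a countable cover. *)
Lemma mu_ext_lt_cover d (T : measurableType d) (R : realType)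
    (mu : {measure set T -> \bar R}) (A : set T) (e : \bar R) :
  mu_ext mu A < e -> exists F, [/\ measurable F, A `<=` F & mu F <= e].
Proof.
move=> /ereal_inf_lt[_ [G [mG AG] <-] Ge].
exists (\bigcup_k G k); split => //; first exact: bigcup_measurable.
apply: le_trans (ltW Ge); apply: generalized_Boole_inequality => //.
exact: bigcup_measurable.
Qed.

Section frozen_kernel.
Context (R : realType) (dX dT : measure_display).
Context (X : measurableType dX) (Theta : measurableType dT).
Variable P : Theta -> R.-pker X ~> X.
Variable Pbar : nat -> R.-pker (X * Theta)%type ~> (X * Theta)%type.
Hypothesis hPbar : forall (n : nat) (x : X) (t : Theta) (A : set X), measurable A ->
    Pbar n (x, t) (A `*` setT) = P t x A.

(** [hPbar] identifies the image of [Pbar n z] under [fst]. *)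
Lemma integral_Pbar_fst n z (f : X -> \bar R) :
  measurable_fun setT f -> (forall x, 0 <= f x) ->
  \int[Pbar n z]_y f y.1 = \int[P z.2 z.1]_y f y.
Proof.
move=> mf f0.
have := @ge0_integral_pushforward _ _ _ _ R fst (@measurable_fst _ _ X Theta)
  (Pbar n z) setT f measurableT mf.
rewrite preimage_setT => <-; last by move=> x _.
apply: eq_measure_integral.
move=> A mA _; have := hPbar n z.1 z.2 mA; rewrite -surjective_pairing => <-.
by congr (Pbar n z _); apply/seteqP; split => // y [].
Qed.

(* [kiter f n (x, t)] is P_t^n f (x), which is jointly measurable in (x, t)
   because it is an integral against [Pbar]. *)
Fixpoint kiter (f : X -> \bar R) (n : nat) (z : X * Theta) : \bar R :=
  if n is m.+1 then \int[P z.2 z.1]_y kiter f m (y, z.2) else f z.1.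

Section kiter.
Variable f : X -> \bar R.
Hypothesis mf : measurable_fun setT f.
Hypothesis f01 : forall x, 0 <= f x <= 1.

Lemma kiter_ge0 n z : 0 <= kiter f n z.
Proof.
elim: n z => [|n ih] z /=; first by case/andP: (f01 z.1).
by apply: integral_ge0.
Qed.

Lemma measurable_kiter n : measurable_fun setT (kiter f n).
Proof.
elim: n => [|n ih] /=; first by apply: measurableT_comp => //;
  exact: measurable_fst.
have -> : (fun z => \int[P z.2 z.1]_y kiter f n (y, z.2)) =
    (fun z => \int[Pbar 0 z]_y kiter f n (y.1, z.2)).
  apply/funext => z;
  rewrite (integral_Pbar_fst 0 z (f := fun x => kiter f n (x, z.2)))//.
  - by apply: measurableT_comp => //; exact: measurable_pair2.
  - by move=> x; exact: kiter_ge0.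
apply: (measurable_fun_integral_finite_kernel (fun y => kiter f n (y.2.1, y.1.2)) (Pbar 0)).
  by move=> y; exact: kiter_ge0.
apply: measurableT_comp => //; apply: measurable_fun_pair.
  by apply: measurableT_comp => //; exact: measurable_snd.
by apply: measurableT_comp => //; exact: measurable_fst.
Qed.

Lemma measurable_kiter_fst n t : measurable_fun setT (fun x => kiter f n (x, t)).
Proof. by apply: measurableT_comp;
  [exact: measurable_kiter|exact: measurable_pair2]. Qed.

Lemma kiter_le1 n z : kiter f n z <= 1.
Proof.
elim: n z => [|n ih] z /=; first by case/andP: (f01 z.1).
apply: (@le_trans _ _ (\int[P z.2 z.1]_y 1)).
  apply: ge0_le_integral => //.
  - by move=> y _; exact: kiter_ge0.
  - exact: measurable_kiter_fst.
by rewrite integral_cst// mul1e sprob_kernel_le1.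
Qed.

(** Composition of kernels is the bind of the Giry monad, so integrating against it gives an
    iterated integral. *)
Lemma integral_kernel_iter n x t :
  \int[kernel_iter (P t) n x]_y f y = kiter f n (x, t).
Proof.
have f0 y : 0 <= f y by case/andP: (f01 y).
elim: n x => [|n ih] x /=; first by rewrite integral_dirac// diracT mul1e.
pose mk := measurable_kernel_giry (kernel_iter (P t) n).
transitivity (\int[giry_bind (kernel_giry (P t) x) mk]_y f y).
  apply: eq_measure_integral => A mA _.
  by rewrite [RHS]giry_int_map//; exact: measurable_giry_ev.
have := giry_int_bind (kernel_giry (P t) x) mk mf f0; rewrite /giry_int => ->.
by apply: eq_integral => y _; rewrite -ih.
Qed.

End kiter.

(** * Comparison of the chain with its frozen version *)

Section coupling.
Variables (mu : {measure set (X * Theta)%type -> \bar R}).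
Variable law : probability (trajectory (X * Theta)%type) R.
Hypothesis law_markov : is_markov_law mu Pbar law.

Lemma measurable_kiter_coordinates f j m n :
  measurable_fun setT f -> (forall x, 0 <= f x <= 1) ->
  measurable_fun setT (fun w : trajectory (X * Theta)%type => kiter f j ((w m).1, (w n).2)).
Proof.
move=> mf f01; apply: measurableT_comp; first exact: measurable_kiter.
apply: measurable_fun_pair.
  by apply: measurableT_comp;
    [exact: measurable_fst|exact: measurable_coordinate].
by apply: measurableT_comp;
  [exact: measurable_snd|exact: measurable_coordinate].
Qed.

(* Outside of [F] the kernel may be frozen at its value at time [n]. *)
Lemma kiter_step f j m n (F : set (trajectory (X * Theta)%type)) (e : R) :
  measurable_fun setT f -> (forall x, 0 <= f x <= 1) ->
  (n <= m)%N -> measurable F -> (0 <= e)%R ->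
  (forall w, ~ F w -> forall x (h : X -> \bar R),
    measurable_fun setT h -> (forall y, 0 <= h y <= 1) ->
    \int[P (w m).2 x]_y h y <= \int[P (w n).2 x]_y h y + e%:E) ->
  \int[law]_w kiter f j ((w m.+1).1, (w n).2) <=
  \int[law]_w kiter f j.+1 ((w m).1, (w n).2) + (e%:E + law F).
Proof.
move=> mf f01 nm mF e0 FP.
have k0 i z : 0 <= kiter f i z by exact: kiter_ge0.
have k1 i z : kiter f i z <= 1 by exact: kiter_le1.
pose h (z : (X * Theta) * (X * Theta)) := kiter f j (z.2.1, z.1.2).
have mh : measurable_fun setT h.
  apply: measurableT_comp; first exact: measurable_kiter.
  apply: measurable_fun_pair.
    by apply: measurableT_comp => //; exact: measurable_snd.
  by apply: measurableT_comp => //; exact: measurable_fst.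
have h0 z : 0 <= h z by exact: k0.
rewrite (markov_step (h := h) law_markov nm (@pastT _ _ m) mh h0).
have mF1 : measurable_fun setT (fun w => (\1_F w)%:E : \bar R).
  by apply/measurable_EFinP; exact: measurable_indic.
have mk : measurable_fun setT
    (fun w : trajectory (X * Theta)%type => kiter f j.+1 ((w m).1, (w n).2)).
  exact: measurable_kiter_coordinates.
have F10 w : 0 <= (\1_F w)%:E :> \bar R by rewrite lee_fin.
(* On [F] the integrand is at most 1, which the indicator pays for; elsewhere the parameter of time
   [m] is exchanged for that of time [n] at cost [e]. *)
apply: (@le_trans _ _ (\int[law]_w
    (kiter f j.+1 ((w m).1, (w n).2) + (e%:E + (\1_F w)%:E)))).
  apply: ge0_le_integral => //.
  - by move=> w _; apply: integral_ge0.
  - exact: measurable_integral_coordinates.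
  - by apply: emeasurable_funD => //; exact: emeasurable_funD.
  move=> w _; rewrite /h /=.
  have mkw : measurable_fun setT (fun x => kiter f j (x, (w n).2)).
    exact: measurable_kiter_fst.
  rewrite (integral_Pbar_fst _ _ (f := fun x => kiter f j (x, (w n).2)))//.
  rewrite indicE; have [wF|wF] := boolP (w \in F).
    apply: (@le_trans _ _ (0 + (0 + 1))).
      rewrite !add0e; apply: (@le_trans _ _ (\int[P (w m).2 (w m).1]_y 1)).
        exact: ge0_le_integral.
      by rewrite integral_cst// mul1e sprob_kernel_le1.
    by apply: leeD; [exact: integral_ge0|rewrite leeD2r// lee_fin].
  rewrite adde0; apply: FP => //; last by move=> y; rewrite k0 k1.
  by move/mem_set; exact/negP.
rewrite ge0_integralD//; last 2 first.
  - by move=> w _; apply: adde_ge0 => //; rewrite lee_fin.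
  - exact: emeasurable_funD.
apply: leeD2l; rewrite ge0_integralD//.
rewrite integral_cst//= integral_indic// setIT.
by rewrite -[X in _ <= X + _]mule1 leeD2r// lee_wpmul2l ?lee_fin// probability_le1.
Qed.

(** Iterates [kiter_step] backwards from time [n + N] to time [n]; each replacement costs [e] plus
    [law F], at most [e + e]. *)
Lemma kiter_steps f n N (F : set (trajectory (X * Theta)%type)) (e : R) :
  measurable_fun setT f -> (forall x, 0 <= f x <= 1) ->
  measurable F -> (0 <= e)%R -> law F <= e%:E ->
  (forall w m, ~ F w -> (n <= m < n + N)%N -> forall x (h : X -> \bar R),
    measurable_fun setT h -> (forall y, 0 <= h y <= 1) ->
    \int[P (w m).2 x]_y h y <= \int[P (w n).2 x]_y h y + e%:E) ->
  \int[law]_w f (w (n + N)%N).1 <=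
  \int[law]_w kiter f N (w n) + ((e + e) *+ N)%:E.
Proof.
move=> mf f01 mF e0 Fe FP.
(* Generalised for the induction: [i] steps of the true chain remain, and [j] steps are already
   frozen. *)
suff H i j : (i <= N)%N -> \int[law]_w kiter f j ((w (n + i)%N).1, (w n).2) <=
    \int[law]_w kiter f (j + i)%N (w n) + ((e + e) *+ i)%:E.
  by have := H N 0%N (leqnn N).
elim: i j => [|i ih] j iN.
  rewrite mulr0n adde0 !addn0 le_eqVlt; apply/orP; left; apply/eqP.
  by apply: eq_integral => w _; rewrite -surjective_pairing.
rewrite !addnS -addSn.
have step := @kiter_step f j (n + i)%N n F e mf f01 (leq_addr _ _) mF e0 _.
apply: (le_trans (step _)).
  by move=> w Fw; apply: FP => //; rewrite leq_addr ltn_add2l.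
apply: (le_trans (leeD (ih j.+1 (ltnW iN)) (leeD2l _ Fe))).
by rewrite -addeA -!EFinD mulrSr.
Qed.

End coupling.
End frozen_kernel.

(** * Convergence *)

Lemma kernel_dist_lt_integral (R : realType) (dX dT : measure_display)
    (X : measurableType dX) (Theta : measurableType dT)
    (P : Theta -> R.-pker X ~> X)
    (t t' : Theta) (e : R) (x : X) (h : X -> \bar R) :
  kernel_dist P t t' < e%:E -> measurable_fun setT h ->
  (forall y, 0 <= h y <= 1) ->
  \int[P t x]_y h y <= \int[P t' x]_y h y + e%:E.
Proof.
move=> tt' mh h01.
apply: tv_dist_le_integral => //;
  [exact: sprob_kernel_le1|exact: sprob_kernel_le1|].
by apply: le_trans (ltW tt'); apply: ereal_sup_ubound; exists x.
Qed.

Section asymptotics.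
Context (R : realType) (dX dT : measure_display).
Context (X : measurableType dX) (Theta : measurableType dT).
Variable P : Theta -> R.-pker X ~> X.
Variable Pbar : nat -> R.-pker (X * Theta)%type ~> (X * Theta)%type.
Hypothesis hPbar : forall (n : nat) (x : X) (t : Theta) (A : set X), measurable A ->
    Pbar n (x, t) (A `*` setT) = P t x A.
Variables (mu : {measure set (X * Theta)%type -> \bar R}).
Variable law : probability (trajectory (X * Theta)%type) R.
Hypothesis law_markov : is_markov_law mu Pbar law.
Variables (V : X -> R) (pi : probability X R).
Hypothesis mV : measurable_fun setT V.
Hypothesis V1 : forall x, (1 <= V x)%R.
Hypothesis h_ergodic : ereal_sup [set ((V x)^-1)%:E *
      ereal_sup [set tv_dist (kernel_iter (P t) n x) pi | t in [set: Theta]]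
    | x in [set: X]] @[n --> \oo] --> 0.
Hypothesis h_adapt : forall eps : R, (0 < eps)%R ->
    mu_ext law [set w | eps%:E <= kernel_dist P (w n.+1).2 (w n).2]
      @[n --> \oo] --> 0.
Hypothesis h_tight : forall e : R, (0 < e)%R -> exists2 M : R, (0 < M)%R &
    forall n, law [set w | (M < V (w n).1)%R] <= e%:E.

(** The threshold [e / M] for the weighted supremum gives an error [e] where [V <= M], uniformly in
    the parameter and in [f]. *)
Let ergodic (M e : R) : (0 < M)%R -> (0 < e)%R ->
  exists N, forall x t (f : X -> \bar R),
  (V x <= M)%R -> measurable_fun setT f -> (forall y, 0 <= f y <= 1) ->
  kiter P f N (x, t) <= \int[pi]_y f y + e%:E.
Proof.
move=> M0 e0; have [N /(_ N (leqnn N)) supN] :=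
  cvge0_near_lt h_ergodic (divr_gt0 e0 M0).
exists N => x t f VM mf f01; rewrite -integral_kernel_iter//.
apply: tv_dist_le_integral => //.
- exact: sprob_kernel_le1.
- exact: probability_le1.
have Vx : (0 < V x)%R by exact: lt_le_trans (V1 x).
set S := ereal_sup [set tv_dist (kernel_iter (P t) N x) pi | t in [set: Theta]].
apply: (@le_trans _ _ S); first by apply: ereal_sup_ubound; exists t.
have : ((V x)^-1)%:E * S <= (e / M)%:E.
  by apply: le_trans (ltW supN); apply: ereal_sup_ubound; exists x.
rewrite lee_pdivrMl// => /le_trans; apply.
by rewrite -EFinM lee_fin mulrCA ler_piMr ?(ltW e0)// ler_pdivrMr// mul1r.
Qed.

(** Off measurable covers of the events where one increment is large, the increments add up by the
    triangle inequality, applied to the integrals of a fixed [h]. *)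
Let adapted N (e : R) : (0 < e)%R -> exists n0, forall n, (n0 <= n)%N ->
  exists F : set (trajectory (X * Theta)%type), [/\ measurable F, law F <= e%:E &
    forall w m, ~ F w -> (n <= m < n + N)%N -> forall x (h : X -> \bar R),
      measurable_fun setT h -> (forall y, 0 <= h y <= 1) ->
      \int[P (w m).2 x]_y h y <= \int[P (w n).2 x]_y h y + e%:E].
Proof.
(* [c] serves twice, as size of each increment and as measure of each cover; there are at most [N]
   of both, and [N.+1] keeps the division meaningful when [N = 0]. *)
move=> e0; pose c := (e / N.+1%:R)%R.
have c0 : (0 < c)%R by rewrite divr_gt0.
have cN i : (i <= N)%N -> (c *+ i <= e)%R.
  move=> iN; rewrite -mulr_natr /c mulrAC ler_pdivrMr// ler_wpM2l ?(ltW e0)//.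
  by rewrite ler_nat; exact: leqW.
have [n0 adapt] := cvge0_near_lt (h_adapt c0) c0.
exists n0 => n n0n.
have /choice[F FP] i :
  exists F : set (trajectory (X * Theta)%type), [/\ measurable F,
    [set w | c%:E <= kernel_dist P (w (n + i).+1).2 (w (n + i)%N).2] `<=` F & law F <= c%:E].
  by apply/mu_ext_lt_cover/adapt; exact: leq_trans (leq_addr _ _).
have mF i : measurable (F i) by case: (FP i).
exists (\big[setU/set0]_(i < N) F i); split.
- exact: bigsetU_measurable.
- apply: (@le_trans _ _ (\sum_(i < N) c%:E)).
    apply: (le_trans (Boole_inequality _ _)) => //.
    by apply: lee_sum => i _; case: (FP i).
  by rewrite sumEFin sumr_const card_ord lee_fin cN.
move=> w m; rewrite -bigcup_mkord => Fw /andP[nm mN] x h mh h01.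
have small i : (i < N)%N ->
  kernel_dist P (w (n + i).+1).2 (w (n + i)%N).2 < c%:E.
  by move=> iN; rewrite ltNge; apply/negP => ci; apply: Fw; exists i => //;
    case: (FP i) => _ + _; exact.
have H i : (i < N)%N ->
    \int[P (w (n + i)%N).2 x]_y h y <= \int[P (w n).2 x]_y h y + (c *+ i)%:E.
  elim: i => [|i ih] iN; first by rewrite addn0 mulr0n adde0.
  have iN' := ltnW iN; rewrite addnS.
  apply: (le_trans (kernel_dist_lt_integral _ (small i iN') mh h01)).
  by rewrite mulrSr EFinD addeA leeD2r// ih.
rewrite -(subnKC nm); have mnN : (m - n < N)%N by rewrite ltn_subLR.
by apply: (le_trans (H _ mnN)); rewrite leeD2l// lee_fin cN// ltnW.
Qed.

(** Order of choices: [M] from tightness, [N] from ergodicity at level [M], then [n0] from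
    adaptation over [N] steps. All precede [f], whence uniformity; each source contributes
    [e / 3]. *)
Lemma integral_limsup (e : R) : (0 < e)%R -> exists n0, forall n, (n0 <= n)%N ->
  forall f : X -> \bar R, measurable_fun setT f -> (forall x, 0 <= f x <= 1) ->
  \int[law]_w f (w n).1 <= \int[pi]_x f x + e%:E.
Proof.
move=> e0; have e3 : (0 < e / 3)%R by rewrite divr_gt0.
have [M M0 tightM] := h_tight e3.
have [N ergN] := ergodic M0 e3.
(* [kiter_steps] costs [e' + e'] for each of its [N] steps, at most [e / 3] in total. *)
pose e' := (e / 3 / (N.+1 * 2)%:R)%R.
have e'0 : (0 < e')%R by rewrite divr_gt0.
have e'N : ((e' + e') *+ N <= e / 3)%R.
  have -> : ((e' + e') *+ N = e / 3 * ((N * 2)%:R / (N.+1 * 2)%:R))%R.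
    by rewrite -mulr2n -mulrnA -[LHS]mulr_natr mulnC /e' -mulrA [(_^-1 * _)%R]mulrC.
  rewrite ler_piMr ?(ltW e3)// ler_pdivrMr// mul1r ler_nat.
  by rewrite leq_mul2r leqnSn.
have [n0 adaptN] := adapted N e'0.
(* The kernel is frozen at time [n' - N], which has to be at least [n0]. *)
exists (n0 + N)%N => n' n0n' f mf f01.
have Nn' : (N <= n')%N := leq_trans (leq_addl _ _) n0n'.
have n0n : (n0 <= n' - N)%N by rewrite leq_subRL// addnC.
have [F [mF Fe FP]] := adaptN _ n0n.
rewrite -(subnK Nn'); set n := (n' - N)%N in FP *.
apply: (le_trans (kiter_steps hPbar law_markov mf f01 mF (ltW e'0) Fe FP)).
pose B := [set w : trajectory (X * Theta)%type | (M < V (w n).1)%R].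
have mB : measurable B.
  have -> : B = (fun w => w n) @^-1` (fst @^-1` (V @^-1` `]M, +oo[)).
    by apply/seteqP; split => w /=; rewrite in_itv/= andbT.
  rewrite -[X in measurable X]setTI; apply: measurable_coordinate => //.
  rewrite -[X in measurable X]setTI; apply: measurable_fst => //.
  by rewrite -[X in measurable X]setTI; exact: mV.
have pif0 : 0 <= \int[pi]_x f x by apply: integral_ge0 => x _;
  case/andP: (f01 x).
have mB1 : measurable_fun setT (fun w => (\1_B w)%:E : \bar R).
  by apply/measurable_EFinP; exact: measurable_indic.
have B10 w : 0 <= (\1_B w)%:E :> \bar R by rewrite lee_fin.
have e3' : 0 <= (e / 3)%:E by rewrite lee_fin ltW.
(* Where [V] exceeds [M] the trivial bound 1 is used, elsewhere the ergodic one. *)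
have kw : \int[law]_w kiter P f N (w n) <=
    \int[law]_w ((\int[pi]_x f x + (e / 3)%:E) + (\1_B w)%:E).
  apply: ge0_le_integral => //.
  - by move=> w _; exact: kiter_ge0.
  - by apply: measurableT_comp;
      [exact: (measurable_kiter hPbar)|exact: measurable_coordinate].
  - exact: emeasurable_funD.
  move=> w _; rewrite indicE; have [wB|wB] := boolP (w \in B).
    apply: (le_trans (kiter_le1 hPbar mf f01 _ _)).
    by rewrite leeDr// adde_ge0.
  rewrite adde0 [w n]surjective_pairing; apply: ergN => //.
  by rewrite leNgt; apply/negP => /= wM; move/negP: wB; apply; rewrite inE.
apply: (le_trans (leeD kw (_ : _ <= (e / 3)%:E))); first by rewrite lee_fin.
rewrite ge0_integralD//; last by move=> w _; exact: adde_ge0.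
rewrite integral_cst//= integral_indic// setIT.
have -> : law setT = 1 by exact: probability_setT.
rewrite mule1; move: (\int[pi]_x f x) => I; rewrite -!addeA; apply: leeD2l.
apply: (@le_trans _ _ ((e / 3)%:E + ((e / 3)%:E + (e / 3)%:E))).
  by rewrite leeD2l// leeD2r//; exact: tightM.
by rewrite -!EFinD lee_fin; lra.
Qed.

(* [integral_limsup] applied to (1 + s f) / 2, s = 1 or -1. *)
Let integral_limsup_half (e : R) : (0 < e)%R ->
  exists n0, forall n, (n0 <= n)%N ->
  forall f : X -> R, unit_ball f -> forall s : R, (`|s| = 1)%R ->
  (s * \int[law]_w f (w n).1 <= s * (\int[pi]_x f x) + e)%R.
Proof.
move=> e0; have e2 : (0 < e / 2)%R by rewrite divr_gt0.
have [n0 limn0] := integral_limsup e2.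
exists n0 => n n0n f [mf f1] s s1.
have mfw : measurable_fun setT (fun w : trajectory (X * Theta)%type => f (w n).1).
  by apply: measurableT_comp => //; apply: measurableT_comp;
    [exact: measurable_fst|exact: measurable_coordinate].
pose g x := ((s / 2) * f x + 1 / 2)%R.
have := limn0 n n0n (EFin \o g); rewrite !integral_affine//.
rewrite -EFinD lee_fin => H.
have {}H := H _ _; suff : (s / 2 * \int[law]_w f (w n).1 + 1 / 2 <=
    s / 2 * \int[pi]_x f x + 1 / 2 + e / 2)%R by lra.
apply: H.
  apply/measurable_EFinP; apply: measurable_funD => //; exact: measurable_funM.
move=> x; rewrite /= !lee_fin /g.
have : (`|s * f x| <= 1)%R by rewrite normrM s1 mul1r.
by rewrite ler_norml => /andP[? ?]; apply/andP; split; lra.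
Qed.

(** The signs 1 and -1 in [integral_limsup_half] give the two halves of the absolute value. *)
Lemma expectation_limit :
  ereal_sup [set `| 'E_law [fun w => f (w n).1 - (\int[pi]_y f y)%R]%R |
    | f in @unit_ball dX X R] @[n --> \oo] --> 0.
Proof.
apply: cvge0_near_le => [n|e e0].
  pose v (f : X -> R) := `| 'E_law [fun w => f (w n).1 - (\int[pi]_y f y)%R]%R |.
  (* The zero function shows that the supremum is nonnegative. *)
  apply: (@le_trans _ _ (v (cst 0%R))); first exact: abse_ge0.
  apply: ereal_sup_ubound; exists (cst 0%R) => //; split => // x.
  by rewrite normr0.
have [n0 limn0] := integral_limsup_half e0; exists n0 => n n0n.
apply: ub_ereal_sup => _ [f bf <-]; have [mf f1] := bf.
have mfw : measurable_fun setT (fun w : trajectory (X * Theta)%type => f (w n).1).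
  by apply: measurableT_comp => //; apply: measurableT_comp;
    [exact: measurable_fst|exact: measurable_coordinate].
have -> : 'E_law [fun w => f (w n).1 - (\int[pi]_y f y)%R]%R =
    (\int[law]_w f (w n).1 - \int[pi]_y f y)%R%:E.
  rewrite unlock.
  have := integral_affine law 1 (- (\int[pi]_y f y)%R)%R mfw (fun w => f1 _).
  by rewrite mul1r => <-; apply: eq_integral => w _; rewrite mul1r.
rewrite abse_EFin lee_fin ler_norml.
have := limn0 n n0n f bf 1%R (normr1 _).
have := limn0 n n0n f bf (-1)%R (normrN1 _).
by move=> ? ?; apply/andP; split; lra.
Qed.

End asymptotics.

Theorem theorem2p1 (R : realType) (dX dT : measure_display)
  (X : measurableType dX) (Theta : measurableType dT)
  (hX : countably_generated X) (hTheta : countably_generated Theta)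
  (P : Theta -> R.-pker X ~> X)
  (hP : forall (x : X) (A : set X), measurable A ->
    measurable_fun setT ((fun t => P t x A) : Theta -> \bar R))
  (Pbar : nat -> R.-pker (X * Theta)%type ~> (X * Theta)%type)
  (hPbar : forall (n : nat) (x : X) (t : Theta) (A : set X), measurable A ->
    Pbar n (x, t) (A `*` setT) = P t x A)
  (* [PP l (x, t)] is the law of the chain started at (x, t) and shifted by l *)
  (PP : nat -> X * Theta -> probability (trajectory (X * Theta)%type) R)
  (hPP : forall (l : nat) (z : X * Theta),
    is_markov_law (\d_z) (fun n => Pbar (l + n)%N) (PP l z))
  (V : X -> R) (mV : measurable_fun setT V) (V1 : forall x, (1 <= V x)%R)
  (C : set X) (mC : measurable C)
  (pi : probability X R)
  (r : nat -> R) (r_gt0 : forall n, (0 < r n)%R)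
  (r_nd : {homo r : m n / (m <= n)%N >-> (m <= n)%R})
  (r_sum : \sum_(0 <= n <oo) ((r n)^-1)%:E < +oo)
  (h_return : ereal_sup [set ereal_sup
      [set \int[PP l z]_w rate r (return_time C w) | z in C `*` setT]
    | l in [set: nat]] < +oo)
  (h_ergodic : ereal_sup [set ((V x)^-1)%:E *
      ereal_sup [set tv_dist (kernel_iter (P t) n x) pi | t in [set: Theta]]
    | x in [set: X]] @[n --> \oo] --> 0)
  (h_drift : forall x, ~ C x ->
    ereal_sup [set \int[P t x]_y (V y)%:E | t in [set: Theta]] <= (V x)%:E)
  (h_small : ereal_sup [set \int[P z.2 z.1]_y (V y)%:E + (V z.1)%:E
    | z in C `*` [set: Theta]] < +oo)
  (xi1 : probability X R) (xi2 : probability Theta R)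
  (Pxi : probability (trajectory (X * Theta)%type) R)
  (hPxi : is_markov_law (xi1 \x xi2) Pbar Pxi)
  (* outer probability, since {D(theta_n, theta_{n-1}) >= eps} need not be
     measurable; it is Pxi itself on measurable sets *)
  (h_adapt : forall eps : R, (0 < eps)%R ->
    mu_ext Pxi [set w | eps%:E <= kernel_dist P (w n.+1).2 (w n).2]
      @[n --> \oo] --> 0) :
  ereal_sup [set `| 'E_Pxi [fun w => f (w n).1 - (\int[pi]_y f y)%R]%R |
    | f in @unit_ball dX X R] @[n --> \oo] --> 0.
Proof.
(* The tightness argument runs on the product space, with a set and a function that depend on the
   first coordinate only. *)
pose T := (X * Theta)%type; pose C' : set T := fst @^-1` C.
have mC' : measurable C'.
  by rewrite -[X in measurable X]setTI; exact: measurable_fst.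
pose V' (z : T) := V z.1.
have mV' : measurable_fun setT V' by apply: measurableT_comp => //;
  exact: measurable_fst.
have V0 x : (0 <= V x)%R by exact: le_trans (V1 x).
have intV l z : \int[Pbar l z]_y (V' y)%:E = \int[P z.2 z.1]_y (V y)%:E.
  apply: (integral_Pbar_fst hPbar l z (f := EFin \o V));
    first exact/measurable_EFinP.
  by move=> x; rewrite lee_fin.
have [A A0 hA] := ereal_sup_bounded h_return.
have [B B0 hB] := ereal_sup_bounded h_small.
have C_small z : C' z -> \int[P z.2 z.1]_y (V y)%:E + (V z.1)%:E <= B%:E.
  by move=> Cz; apply: hB; exists z.
have intV0 z : 0 <= \int[P z.2 z.1]_y (V y)%:E.
  by apply: integral_ge0 => y _; rewrite lee_fin.
(* Markov's inequality: [r m] times the avoidance probability is at most the expected rate of the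
   return time, itself at most [A]. *)
have C_avoid m l z : C' z -> avoid_prob Pbar C' m l z <= (A / r m)%:E.
  move=> Cz; rewrite (avoid_prob_dirac mC' m (hPP l z)).
  rewrite mulrC EFinM lee_pdivlMl//.
  apply: (@le_trans _ _ (\int[PP l z]_w rate r (return_time C w))).
    apply: le_integral_lower.
    - by apply: past_measurable (0 + m)%N _ _; exact: past_avoid.
    - exact: ltW.
    - by move=> w; rewrite /rate; case: return_time => [n|];
        rewrite ?lee_fin ?ltW// leey.
    - by move=> w; exact: rate_return_time_ge.
  apply: (@le_trans _ _ (ereal_sup
    [set \int[PP l z]_w rate r (return_time C w) | z in C `*` setT])).
    by apply: ereal_sup_ubound; exists z.
  by apply: hA; exists l.
have a_sum : \sum_(0 <= n <oo) (A / r n)%:E < +oo.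
  under eq_eseriesr do rewrite EFinM.
  rewrite nneseriesZl; last by move=> n _; rewrite lee_fin invr_ge0 ltW.
  by apply: lte_mul_pinfty => //; rewrite ?lee_fin.
apply: (expectation_limit hPbar hPxi mV V1 h_ergodic h_adapt) => e e0.
apply: (@markov_tight _ T _ _ _ _ hPxi C' V' (fun m => A / r m)%R B) => //.
- by move=> z; exact: V0.
- by move=> m; rewrite divr_ge0// ltW.
(* Both terms of the sum in [C_small] are nonnegative, so [B] bounds each of them. *)
- move=> l z Cz; rewrite intV; apply: le_trans (C_small z Cz).
  by rewrite leeDl// lee_fin.
- move=> z Cz; rewrite -lee_fin; apply: le_trans (C_small z Cz).
  by rewrite leeDr.
- move=> l z Cz; rewrite intV; apply: le_trans (h_drift z.1 Cz).
  by apply: ereal_sup_ubound; exists z.2.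
Qed.
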